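(* Let $n>2$ and $N>1$ be integers. Then there exist infinitely many number fields $K$ of degree $[K:\mathbb{Q}]=n$ whose minimal index satisfies $\operatorname{Ind}_{\min}(K)>N$.
   Context: For a number field $K$ with ring of integers $\mathcal{O}_K$, the minimal index of $K$ is $$\operatorname{Ind}_{\min}(K) := \min_{\alpha\in\mathcal{O}_K,\ K=\mathbb{Q}(\alpha)} \big[\mathcal{O}_K:\mathbb{Z}[\alpha]\big],$$ where $[\mathcal{O}_K:\mathbb{Z}[\alpha]]$ is the (finite) index of $\mathbb{Z}[\alpha]$ in $\mathcal{O}_K$ as additive groups. *)

(* Defs.v *)
From mathcomp Require Import all_boot all_order all_algebra all_field.
From mathcomp Require Import finmap.
From mathcomp Require Import all_classical.

Set Implicit Arguments.
Unset Strict Implicit.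
Unset Printing Implicit Defensive.

Import Order.TTheory GRing.Theory Num.Theory.

Local Open Scope classical_set_scope.
Local Open Scope ring_scope.

(* A number field is a [fieldExtType rat], i.e. a finite extension of Q; its
   degree is the dimension [\dim {:K}] of the whole field over Q. *)

Definition ring_of_integers (K : fieldExtType rat) : set K :=
  [set x | integralOver (intr : int -> K) x].

Definition int_adjoin (K : fieldExtType rat) (a : K) : set K :=
  [set (map_poly (intr : int -> K) p).[a] | p in [set: {poly int}]].

Definition cosets (V : zmodType) (G H : set V) : set (set V) :=
  [set [set x + h | h in H] | x in G].

(* Since [fset_set] sends infinite sets to the empty one, an infinite index
   is represented by 0. *)
Definition add_index (V : zmodType) (G H : set V) : nat :=
  #|` fset_set (cosets G H)|%fset.

Definition monogenic_indices (K : fieldExtType rat) : set nat :=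
  [set add_index (ring_of_integers (K := K)) (int_adjoin a)
     | a in [set a : K | ring_of_integers a /\ <<1; a>>%VS = {:K}%VS]].

(* The set [S] of natural numbers here is nonempty for every number field, so
   the default value 0 of [xget] is never used. *)
Definition min_index (K : fieldExtType rat) : nat :=
  let S := monogenic_indices K in
  xget 0%N [set m | S m /\ forall k, S k -> (m <= k)%N].

Definition field_iso (K L : fieldExtType rat) : Prop :=
  exists f : {rmorphism K -> L}, bijective f.

(* Main.v *)
Require Import Defs.
From mathcomp Require Import all_boot all_order all_algebra all_field.
From mathcomp Require Import finmap ring zify.
From mathcomp Require Import all_classical.

Set Implicit Arguments.
Unset Strict Implicit.
Unset Printing Implicit Defensive.

Import Order.TTheory GRing.Theory Num.Theory.

Local Open Scope classical_set_scope.
Local Open Scope ring_scope.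

(** Fix n > 2 and put m = 'C(n, 2), e = 'C(n - 1, 2), so that 0 < e < m.  Let p
    and q be distinct primes and K = Q(a) with a^n = p q^(n-1).  This field is
    totally ramified at p, which constrains all the indices modulo p.

    Let b be an integer of K that generates K, and consider the determinant of
    the coordinates of 1, b, ..., b^(n-1) over the basis 1, a, ..., a^(n-1).

    Globally, let L be the lattice spanned by 1 and the integers a^i / q^(i-1)
    for 0 < i < n.  If x = sum c_i a^i is an integer, then so is
    n c_i a^i, which is a combination of the conjugates of x with roots of unity
    as coefficients; its n-th power is rational, and this forces n x to lie in L
    ([integral_coef_pure_radical], [int_pure_radical]).  Hence the integers form
    a lattice of determinant det B / (n^n q^e), for an integer matrix B whose
    determinant divides n^n ([ring_of_integers_lattice]): what happens at the
    primes dividing n is confined to the bounded factor det B.  The determinant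
    of the powers of b is then, up to sign, index * det B / (n^n q^e)
    ([index_matrix], [add_index_row_lattice]).

    Locally, some multiple k b is an integer polynomial h in a, and since a^n
    vanishes modulo p, the powers of k b are there the truncations at X^n of the
    powers of h.  Their determinant is h_1^m ([det_coef_powers],
    [det_powers_mod_p]).  Comparing the two computations gives

      n^n q^e h_1^m = +- k^m * index * det B   modulo p.

    Now let p be such that -1 and all the integers up to max (N, n^n) are m-th
    powers modulo p, while q^e is not ([exists_good_primes]).  An index at most N
    would make q^e an m-th power, so all the indices exceed N.  The prime p comes
    from reducing a number field that contains the required m-th roots
    ([integral_relations_mod_prime]), and q exists because there are residues
    whose e-th power is not an m-th power ([exists_nonpower_prime]).

    A single field for every bound is enough: the minimal index is invariant
    under isomorphism, so fields with strictly increasing minimal indices are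
    pairwise non-isomorphic. *)

(** * Prime divisors of polynomial values *)
Lemma Fp_intr_eq0 p (a : int) : prime p ->
  ((a%:~R : 'F_p) == 0) = (p %| a)%Z.
Proof. by move=> p_pr; rewrite (dvdz_pcharf (pchar_Fp p_pr)). Qed.

Lemma exists_nonroot (f : {poly int}) : f != 0 -> exists y : nat, f.[y%:Z] != 0.
Proof.
move=> f0; pose rs := [seq (k%:Z : int) | k <- iota 0 (size f)].
have /allPn[_ /mapP[y _ ->] ny] : ~~ all (root f) rs.
  apply/negP => all_rs.
  have urs : uniq rs by rewrite map_inj_uniq ?iota_uniq // => a b [].
  by have := max_poly_roots f0 all_rs urs; rewrite size_map size_iota ltnn.
by exists y; rewrite -rootE.
Qed.

(** Euclid's argument.  Let c = f(0) be nonzero.  If c (B+2)! divides x, then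
    f(x) is c times an integer congruent to 1 modulo (B+2)!.  The prime factors of
    this cofactor exceed B, and there is one as soon as f(x) is neither c nor
    -c. *)
Lemma prime_divides_value (f : {poly int}) (B : nat) : (1 < size f)%N ->
  exists2 p : nat, prime p /\ (B < p)%N & exists x : int, (p %| f.[x])%Z.
Proof.
move=> sz_f; set c := f.[0].
have [c0 | c0] := eqVneq c 0.
  have [p Bp p_pr] := prime_above B.
  by exists p => //; exists 0; rewrite -/c c0 dvdz0.
have [h fE] : exists h, f = h * 'X + c%:P.
  have [h] : {h | f - c%:P = h * 'X}.
    apply/sig_eqW; have /factor_theorem[h fE] : root (f - c%:P) 0.
      by rewrite rootE !hornerE subrr.
    by exists h; rewrite fE subr0.
  by move/(canRL (subrK _)) => ->; exists h.
pose g := f \Po ((c * (B.+2)`!%:Z) *: 'X).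
have k0 : c * (B.+2)`!%:Z != 0.
  by rewrite mulf_neq0 // eqz_nat -lt0n fact_gt0.
have sz_g : size g = size f.
  rewrite size_comp_poly2 // size_scale // ?size_polyX //.
have nz : (g - c%:P) * (g + c%:P) != 0.
  rewrite mulf_neq0 // -size_poly_eq0 ?size_polyDl ?size_polyN ?sz_g;
  by rewrite ?size_polyC ?c0 // -lt0n ltnW.
have [y] := exists_nonroot nz.
rewrite hornerM mulf_eq0 !hornerE => /norP[yB yD].
set x := c * (B.+2)`!%:Z * y%:Z.
have gx : g.[y%:Z] = f.[x] by rewrite /g horner_comp !hornerE.
rewrite !gx in yB yD.
pose u := 1 + (B.+2)`!%:Z * (y%:Z * h.[x]).
have fx : f.[x] = c * u.
  by rewrite fE !(hornerD, hornerM, hornerX, hornerC) /u /x; ring.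
have u1 : (1 < `|u|)%N.
  rewrite ltn_neqAle eq_sym absz_gt0; apply/andP; split.
    apply/negP => /eqP u1.
    have [u1'|u1'] : u = 1 \/ u = -1 by case: (u) u1 => [] [|[]] //=; auto.
      by rewrite fx u1' mulr1 subrr eqxx in yB.
    by rewrite fx u1' mulrN1 addNr eqxx in yD.
  (* u is odd, because the factorial is that of B + 2, not of B *)
  apply/eqP => u0.
  have : (2 %| u)%Z by rewrite u0 dvdz0.
  have d2 : (2%:Z %| (B.+2)`!%:Z * (y%:Z * h.[x]))%Z.
    by apply: dvdz_mulr; apply: dvdn_fact.
  by rewrite /u (rpredDr _ d2).
pose p := pdiv `|u|%N.
have p_pr : prime p by apply: pdiv_prime.
have pu : (p %| u)%Z by rewrite /dvdz /=; apply: pdiv_dvd.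
exists p; last by exists x; rewrite fx dvdz_mull.
split=> //; rewrite ltnNge; apply/negP => pB.
have dp : (p%:Z %| (B.+2)`!%:Z * (y%:Z * h.[x]))%Z.
  apply: dvdz_mulr; apply: dvdn_fact.
  by rewrite prime_gt0 //= (leq_trans pB) // -addn2 leq_addr.
move: pu; rewrite /u (rpredDr _ dp) => p1.
have : (p %| 1)%N := p1.
by rewrite dvdn1 => /eqP p1'; rewrite p1' in p_pr.
Qed.

(** * Reducing algebraic relations modulo a prime *)

(** The composite of P with g / d, multiplied by d ^ size P to clear the
    denominators, so that Gauss's lemma applies to it. *)
Definition homogenized_comp (P g : {poly int}) (d : int) : {poly int} :=
  \sum_(k < size P) (P`_k * d ^+ (size P - k)) *: g ^+ k.

Lemma horner_homogenized_comp (R : fieldType) (P g : {poly int}) (d : int) (y : R) :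
  d%:~R != 0 :> R ->
  (map_poly intr (homogenized_comp P g d)).[y] =
    d%:~R ^+ size P * (map_poly intr P).[(map_poly intr g).[y] / d%:~R].
Proof.
move=> d0; rewrite [in RHS](horner_coef_wide _ (size_poly _ _)).
rewrite /homogenized_comp rmorph_sum horner_sum.
rewrite mulr_sumr; apply: eq_bigr => k _.
rewrite /= map_polyZ hornerZ rmorphXn horner_exp /= coef_map rmorphM rmorphXn /=.
have -> : d%:~R ^+ size P = d%:~R ^+ (size P - k) * d%:~R ^+ k :> R.
  by rewrite -exprD subnK // ltnW.
rewrite expr_div_n.
by field; rewrite expf_eq0 (negPf d0) andbF.
Qed.

(** Primes of degree one, in elementary form.  Every s_i is a rational polynomial
    in one algebraic number z.  Sending z to a root modulo p of its primitive
    minimal polynomial defines the v_i, for a prime p that divides a value of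
    that polynomial and none of the denominators; by Gauss's lemma, integer
    relations satisfied by s_i remain true of v_i. *)
Lemma integral_relations_mod_prime (s : seq algC) (B : nat) :
  exists2 p, prime p /\ (B < p)%N & exists v : nat -> 'F_p,
    forall i (P : {poly int}), (i < size s)%N ->
      root (map_poly intr P) s`_i -> root (map_poly intr P) (v i).
Proof.
have [z _ [ps sE]] := algC_PET s.
have [F [FC monF] dvF] := minCpolyP z.
have [F1 [a a0 FE]] := rat_poly_scale F.
pose g i : {poly int} := projT1 (rat_poly_scale ps`_i).
pose d i : int := s2val (projT2 (rat_poly_scale ps`_i)).
have d0 i : d i != 0 := s2valP (projT2 (rat_poly_scale ps`_i)).
have psE i : ps`_i = (d i)%:~R^-1 *: map_poly intr (g i) :=
  s2valP' (projT2 (rat_poly_scale ps`_i)).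
pose D := \prod_(i < size s) d i.
have D0 : D != 0 by apply/prodf_neq0 => i _.
have szF : (1 < size (zprimitive F1))%N.
  rewrite size_zprimitive -(size_rat_int_poly F1) -(@size_scale _ a%:~R^-1) -?FE.
    by have := size_minCpoly z; rewrite FC size_map_poly.
  by rewrite invr_eq0 intr_eq0.
have [p [p_pr ltp] [x px]] := prime_divides_value (maxn B `|D|) szF.
move: ltp; rewrite gtn_max => /andP[Bp Dp].
exists p => //; exists (fun i => (map_poly intr (g i)).[x%:~R] / (d i)%:~R).
move=> i P lti rootP.
have di0 : (d i)%:~R != 0 :> 'F_p.
  rewrite Fp_intr_eq0 //; apply/negP => pd.
  have : (p %| D)%Z by rewrite /D (bigD1 (Ordinal lti)) //= dvdz_mulr.
  by rewrite /dvdz /= => /dvdn_leq; rewrite absz_gt0 D0 => /(_ isT); rewrite leqNgt Dp.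
have : F %| map_poly intr (homogenized_comp P (g i) (d i)).
  rewrite -dvF -map_poly_comp (eq_map_poly (ratr_int _)) rootE.
  rewrite horner_homogenized_comp ?intr_eq0 // mulf_eq0; apply/orP; right.
  move: rootP; rewrite rootE sE (nth_map 0); last by move: lti; rewrite sE size_map.
  rewrite psE map_polyZ hornerZ -map_poly_comp (eq_map_poly (ratr_int _)) /=.
  by rewrite fmorphV [X in X^-1]ratr_int mulrC.
rewrite FE dvdpZl ?invr_eq0 ?intr_eq0 // dvdp_rat_int => /dvdpP_int[r Er].
have := horner_homogenized_comp P (g i) x%:~R di0.
rewrite Er rmorphM hornerM /= horner_map /=.
move: px; rewrite -Fp_intr_eq0 // => /eqP ->; rewrite mul0r => /esym/eqP.
by rewrite mulf_eq0 expf_eq0 (negPf di0) andbF.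
Qed.

(** * Power residues *)

(** This expresses primitivity by one equation with integer coefficients, which
    can be transported to F_p. *)
Lemma prod_1_sub_prim_root (R : fieldType) (m : nat) (z : R) :
  m.-primitive_root z -> \prod_(1 <= i < m) (1 - z ^+ i) = m%:R.
Proof.
move=> zP; have m_gt0 := prim_order_gt0 zP.
have : \prod_(1 <= i < m) ('X - (z ^+ i)%:P) = \sum_(i < m) 'X^i :> {poly R}.
  have X1 : ('X - 1%:P : {poly R}) != 0 by rewrite monic_neq0 ?monicXsubC.
  apply: (mulfI X1).
  have := factor_Xn_sub_1 zP; rewrite (big_ltn m_gt0) expr0 => ->.
  by rewrite polyC1 subrX1.
move/(congr1 (horner_eval 1)); rewrite rmorph_prod rmorph_sum /= => E.
transitivity (\sum_(i < m) (1 : R)); last by rewrite sumr_const card_ord.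
transitivity (\sum_(i < m) horner_eval 1 ('X^i : {poly R})); last first.
  by apply: eq_bigr => i _; rewrite /horner_eval hornerXn expr1n.
by rewrite -E; apply: eq_bigr => i _; rewrite /horner_eval !hornerE.
Qed.

Definition is_power (F : pzRingType) (m : nat) (x : F) : Prop := exists y, x = y ^+ m.

Lemma is_powerM (F : fieldType) m (x y : F) : is_power m x -> is_power m y -> is_power m (x * y).
Proof. by move=> [a ->] [b ->]; exists (a * b); rewrite exprMn. Qed.

Lemma is_power1 (F : fieldType) m : is_power m (1 : F).
Proof. by exists 1; rewrite expr1n. Qed.

Lemma is_powerX (F : fieldType) m (x : F) k : is_power m x -> is_power m (x ^+ k).
Proof. by move=> [a ->]; exists (a ^+ k); rewrite exprAC. Qed.

Lemma is_powerV (F : fieldType) m (x : F) : is_power m x -> is_power m x^-1.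
Proof. by move=> [a ->]; exists a^-1; rewrite exprVn. Qed.

(** Otherwise, by factoring the integers below p, the e-th powers of all the
    nonzero residues would be m-th powers.  The p - 1 nonzero residues would then
    be roots of unity of order dividing e (p - 1) / m, which is less than p - 1. *)
Lemma exists_nonpower_prime (p m e : nat) (w : 'F_p) :
    prime p -> m.-primitive_root w -> (0 < e < m)%N ->
  exists2 q, prime q /\ (q < p)%N & ~ is_power m ((q%:R : 'F_p) ^+ e).
Proof.
move=> p_pr wP /andP[e_gt0 e_lt].
have m_gt0 := prim_order_gt0 wP.
have fermat (x : 'F_p) : x != 0 -> x ^+ p.-1 = 1.
  move=> x0; apply: (mulfI x0); rewrite mulr1 -exprS prednK ?prime_gt0 //.
  by have := expf_card x; rewrite card_Fp.
have w0 : w != 0 by rewrite (prim_root_eq0 wP) -lt0n.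
have m_dvd : (m %| p.-1)%N by rewrite (prim_order_dvd wP) fermat.
have p1_gt0 : (0 < p.-1)%N by rewrite -subn1 subn_gt0 prime_gt1.
case: (boolP [exists q : 'I_p, prime q && ~~ [exists y : 'F_p, (q%:R : 'F_p) ^+ e == y ^+ m]]).
  case/existsP=> q /andP[q_pr /existsPn nq]; exists q; first by split.
  by case=> y /eqP; apply/negP.
move/existsPn => all_pow; exfalso.
have prime_pow q : prime q -> (q < p)%N -> is_power m ((q%:R : 'F_p) ^+ e).
  move=> q_pr qp; have := all_pow (Ordinal qp); rewrite q_pr negbK.
  by case/existsP=> y /eqP; exists y.
have nat_pow k : (0 < k < p)%N -> is_power m ((k%:R : 'F_p) ^+ e).
  have [b] := ubnP k; elim: b k => // b IH k lekb /andP[k_gt0 kp].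
  have [k1|k1] := leqP k 1.
    have -> : k = 1%N by apply/eqP; rewrite eqn_leq k1.
    by rewrite expr1n; apply: is_power1.
  have d_pr := pdiv_prime k1; have d_dvd := pdiv_dvd k.
  rewrite -(divnK d_dvd) natrM exprMn; apply: is_powerM.
    have lt_k : (k %/ pdiv k < k)%N by rewrite ltn_Pdiv // prime_gt1.
    apply: IH; first exact: leq_trans lt_k lekb.
    by rewrite divn_gt0 ?pdiv_gt0 // pdiv_leq //= (ltn_trans lt_k).
  by apply: prime_pow => //; apply: leq_ltn_trans kp; rewrite pdiv_leq.
pose K := (e * (p.-1 %/ m))%N.
have K_gt0 : (0 < K)%N by rewrite muln_gt0 e_gt0 divn_gt0 // dvdn_leq.
have K_lt : (K < p.-1)%N.
  by rewrite /K -{2}(divnK m_dvd) mulnC ltn_pmul2l // divn_gt0 // dvdn_leq.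
pose rs := [seq (k%:R : 'F_p) | k <- iota 1 p.-1].
have rs_roots : all K.-unity_root rs.
  apply/allP => _ /mapP[k k_in ->]; rewrite unity_rootE.
  have k_lt : (0 < k < p)%N.
    by move: k_in; rewrite mem_iota add1n (prednK (prime_gt0 p_pr)).
  have [y yE] := nat_pow k k_lt.
  have k0 : (k%:R : 'F_p) != 0.
    rewrite -(dvdn_pcharf (pchar_Fp p_pr)).
    by apply/negP => /dvdn_leq; case/andP: k_lt => -> kp /(_ isT); rewrite leqNgt kp.
  rewrite /K exprM yE -exprM mulnC divnK // fermat //.
  apply: contraNneq k0 => y0; move: yE; rewrite y0 expr0n gtn_eqF //=.
  by move/eqP; rewrite expf_eq0 => /andP[].
have rs_uniq : uniq rs.
  rewrite map_inj_in_uniq ?iota_uniq // => a b.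
  rewrite !mem_iota add1n (prednK (prime_gt0 p_pr)) => /andP[_ ap] /andP[_ bp] /(congr1 val) /=.
  by rewrite !val_Fp_nat // !modn_small.
have := max_unity_roots K_gt0 rs_roots rs_uniq.
by rewrite size_map size_iota leqNgt K_lt.
Qed.

Lemma root_intr_XnsubC (R : comNzRingType) (c : int) m (x : R) :
  root (map_poly intr ('X^m - c%:P)) x = (x ^+ m == c%:~R).
Proof.
by rewrite rootE rmorphB /= map_polyXn map_polyC !hornerE subr_eq0.
Qed.

(** The prime p is obtained by reducing a primitive m-th root of unity, an m-th
    root of -1 and an m-th root of each k <= X; the first of these forces m to
    divide p - 1.  As the integers up to X are m-th powers, q exceeds X. *)
Lemma exists_good_primes (m e X : nat) : (0 < e < m)%N ->
  exists p q : nat,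
    [/\ prime p, prime q, (q < p)%N & (X < q)%N] /\
    [/\ (forall k, (k <= X)%N -> is_power m (k%:R : 'F_p)),
        is_power m (-1 : 'F_p) & ~ is_power m ((q%:R : 'F_p) ^+ e)].
Proof.
move=> em; have m_gt0 : (0 < m)%N by case/andP: em => e0; apply: ltn_trans.
have [z zP] := C_prim_root_exists m_gt0.
pose s := z :: m.-root (-1) :: [seq m.-root (k%:R) | k <- iota 0 X.+1] : seq algC.
have [p [p_pr]] := integral_relations_mod_prime s (maxn X m).
rewrite gtn_max => /andP[Xp mp] [v vP].
have w1 : v 0%N ^+ m = 1.
  apply/eqP; have := vP 0%N ('X^m - 1%:P) isT.
  by rewrite !root_intr_XnsubC /= (prim_expr_order zP) eqxx; apply.
have wprod : \prod_(1 <= i < m) (1 - v 0%N ^+ i) = m%:R.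
  have E (R : comNzRingType) (x : R) :
      root (map_poly intr (\prod_(1 <= i < m) (1 - 'X^i) - m%:Z%:P)) x
        = (\prod_(1 <= i < m) (1 - x ^+ i) == m%:R).
    rewrite rootE rmorphB rmorph_prod /= hornerD hornerN horner_prod map_polyC hornerC subr_eq0.
    by congr (_ == _); apply: eq_bigr => i _; rewrite rmorphB rmorph1 /= map_polyXn !hornerE.
  apply/eqP; have := vP 0%N (\prod_(1 <= i < m) (1 - 'X^i) - m%:Z%:P) isT.
  by rewrite !E prod_1_sub_prim_root // eqxx; apply.
(* m is not 0 in F_p, so none of the factors 1 - v_0 ^ i vanishes *)
have wP : m.-primitive_root (v 0%N).
  have [k kP k_dvd] := prim_order_exists m_gt0 w1.
  have [<- //|k_neq] := eqVneq k m.
  have k_gt0 := prim_order_gt0 kP.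
  have k_lt : (k < m)%N by rewrite ltn_neqAle k_neq dvdn_leq.
  have : \prod_(1 <= i < m) (1 - v 0%N ^+ i) = 0.
    by apply/eqP; rewrite prodf_seq_eq0; apply/hasP; exists k;
      rewrite ?mem_index_iota ?k_gt0 //= (prim_expr_order kP) subrr.
  move/eqP; rewrite wprod -(dvdn_pcharf (pchar_Fp p_pr)) => /(dvdn_leq m_gt0).
  by rewrite leqNgt mp.
have [q [q_pr qp] nq] := exists_nonpower_prime p_pr wP em.
have small_pow k : (k <= X)%N -> is_power m (k%:R : 'F_p).
  move=> kX; exists (v k.+2).
  have lt_k : (k.+2 < size s)%N by rewrite /= size_map size_iota.
  apply/esym/eqP; have := vP k.+2 ('X^m - k%:Z%:P) lt_k.
  rewrite !root_intr_XnsubC [s`__](nth_map 0%N) ?size_iota // nth_iota //.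
  by rewrite rootCK // eqxx; apply.
exists p, q; split; split=> //.
  rewrite ltnNge; apply/negP => qX; apply: nq; exact/is_powerX/small_pow.
exists (v 1%N).
apply/esym/eqP; have := vP 1%N ('X^m - (-1)%:P) isT.
by rewrite !root_intr_XnsubC /= rootCK // eqxx; apply.
Qed.

(** * The determinant of the powers of a truncated polynomial *)

(** Write h = c + g X.  The binomial theorem factors the matrix into a unipotent
    lower triangular one, which passes from powers of g X to powers of h, and an
    upper triangular one with diagonal entries g(0) ^ j. *)
Lemma det_coef_powers (R : comNzRingType) (n : nat) (h : {poly R}) :
  \det (\matrix_(j < n, i < n) (h ^+ j)`_i) = h`_1 ^+ 'C(n, 2).
Proof.
have [g hE] : exists g, h = g * 'X + (h`_0)%:P.
  exists (drop_poly 1 h); rewrite -['X]expr1 -{1}(poly_take_drop 1 h) addrC; congr (_ + _).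
  by apply/polyP => i; rewrite coef_take_poly coefC; case: i.
set c := h`_0 in hE.
have -> : \matrix_(j < n, i < n) (h ^+ j)`_i =
    (\matrix_(j < n, k < n) (c ^+ (j - k) *+ 'C(j, k)))
    *m (\matrix_(k < n, i < n) ((g * 'X) ^+ k)`_i).
  apply/matrixP => j i; rewrite !mxE {1}hE addrC exprDn coef_sum.
  pose G k := (c%:P ^+ (j - k) * (g * 'X) ^+ k *+ 'C(j, k))`_i.
  rewrite (big_ord_widen _ G (ltn_ord j)) /G.
  rewrite big_mkcond /=; apply: eq_bigr => k _; rewrite !mxE.
  case: ifP => [_|]; first by rewrite coefMn -polyC_exp coefCM mulrnAl.
  by move/negbT; rewrite -leqNgt => ltjk; rewrite bin_small // mulr0n mul0r.
rewrite det_mulmx det_trig; last first.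
  by apply/is_trig_mxP => j k ltjk; rewrite mxE bin_small ?mulr0n.
rewrite big1 ?mul1r => [|j _]; last by rewrite mxE subnn binn.
rewrite -det_tr det_trig; last first.
  apply/is_trig_mxP => i k ltik; rewrite !mxE exprMn coefMXn.
  by rewrite ltik.
rewrite -triangular_sum big_mkord -prodrXr; apply: eq_bigr => i _.
rewrite !mxE exprMn coefMXn ltnn subnn -!horner_coef0 horner_exp; congr (_ ^+ _).
by rewrite horner_coef0 hE coefD coefMX coefC /= addr0.
Qed.

(** * Integrality of the coordinates over a radical *)

(** Valuations decide: p does not divide d since i < n, and if q^j is the exact
    power of q in d, then n j <= (n - 1) i, that is j <= i - 1 when i > 0 and
    j = 0 when i = 0. *)
Lemma dvdn_pure_radical (p q n i d : nat) : prime p -> prime q -> p != q -> (i < n)%N ->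
  (d ^ n %| p ^ i * q ^ (n.-1 * i))%N -> (d %| q ^ i.-1)%N.
Proof.
move=> p_pr q_pr pq lt_in dn.
have n_gt0 : (0 < n)%N by apply: leq_ltn_trans lt_in.
have npd : ~~ (p %| d)%N.
  apply/negP => pd; have : (p ^ n %| p ^ i * q ^ (n.-1 * i))%N.
    by apply: dvdn_trans dn; rewrite dvdn_exp2r.
  rewrite pfactor_dvdn // ?muln_gt0 ?expn_gt0 ?prime_gt0 //.
  rewrite lognM ?expn_gt0 ?prime_gt0 // pfactorK // lognX logn_prime // (negPf pq) muln0 addn0.
  by rewrite leqNgt lt_in.
have dq : (d ^ n %| q ^ (n.-1 * i))%N.
  rewrite -(@Gauss_dvdr _ (p ^ i)) //.
  by rewrite coprimeXl // coprimeXr // coprime_sym prime_coprime.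
have /(dvdn_pfactor _ _ q_pr)[j _ dE] : (d %| q ^ (n.-1 * i))%N.
  by apply: dvdn_trans dq; rewrite dvdn_exp.
move: dq; rewrite dE -expnM !dvdn_Pexp2l ?prime_gt1 //.
by move: n_gt0; clear; case: n => // n _; case: i => [|i] /=; nia.
Qed.

Lemma int_pure_radical (p q n i : nat) (y : rat) :
  prime p -> prime q -> p != q -> (i < n)%N ->
  y ^+ n * (p * q ^ n.-1)%:R ^+ i \is a Num.int -> y * (q ^ i.-1)%:R \is a Num.int.
Proof.
move=> p_pr q_pr pq lt_in /intrP[z zE].
have d0 : denq y != 0 by apply: denq_neq0.
have : (`|denq y| ^ n %| p ^ i * q ^ (n.-1 * i))%N.
  rewrite -(@Gauss_dvdr _ (`|numq y| ^ n)); last first.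
    by rewrite coprimeXl // coprimeXr // coprime_sym coprime_num_den.
  have E : numq y ^+ n * ((p * q ^ n.-1) ^ i)%N%:Z = z * denq y ^+ n.
    apply: (@intr_inj rat); rewrite !rmorphM !rmorphXn /= -zE.
    rewrite -{2}[y]divq_num_den expr_div_n -natrX.
    by field; rewrite expf_neq0 ?intr_eq0.
  move/(congr1 absz): E; rewrite !abszM !abszX absz_nat expnMn -expnM => E.
  by rewrite E dvdn_mull.
move/(dvdn_pure_radical p_pr q_pr pq lt_in) => dq.
rewrite -{1}[y]divq_num_den -mulrA; apply: rpredM; first exact: rpred_int.
have [k ->] := dvdnP dq.
rewrite natrM mulrC -mulrA; apply: rpredM; first by rewrite rpred_nat.
have -> : `|denq y|%:R = (denq y)%:~R :> rat.
  by rewrite -[in RHS](gez0_abs (denq_ge0 y)).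
by rewrite divff ?intr_eq0.
Qed.

Lemma sum_prim_root_powers (R : fieldType) (n a : nat) (z : R) : n.-primitive_root z ->
  \sum_(j < n) z ^+ (j * a) = if (n %| a)%N then n%:R else 0.
Proof.
move=> zP; have -> : \sum_(j < n) z ^+ (j * a) = \sum_(j < n) (z ^+ a) ^+ j.
  by apply: eq_bigr => j _; rewrite -exprM mulnC.
case: ifP => [na|/negbT na].
  have /eqP -> : z ^+ a == 1 by rewrite -(prim_order_dvd zP).
  by under eq_bigr do rewrite expr1n; rewrite sumr_const card_ord.
apply/eqP; rewrite (prim_order_dvd zP) -subr_eq0 in na.
by rewrite -(mulrI_eq0 _ (mulfI na)) -subrX1 exprAC (prim_expr_order zP) expr1n subrr.
Qed.

(** By hypothesis P vanishes at g (z^j r) for all the n-th roots z^j r of M.  These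
    conjugates are therefore algebraic integers, and so is their Fourier
    coefficient n g_i r^i, whose n-th power is rational. *)
Lemma integral_coef_pure_radical (n M : nat) (g : {poly rat}) (P : {poly int}) :
  (0 < n)%N -> (size g <= n)%N -> P \is monic ->
  'X^n - M%:R%:P %| map_poly intr P \Po g ->
  forall i, (i < n)%N -> (n%:R * g`_i) ^+ n * M%:R ^+ i \is a Num.int.
Proof.
move=> n_gt0 sz_g P_mon dvP i lt_in.
have [z zP] := C_prim_root_exists n_gt0.
pose r : algC := n.-root M%:R.
have rn : r ^+ n = M%:R by rewrite rootCK.
pose x (j : nat) : algC := (map_poly ratr g).[z ^+ j * r].
have x_int j : x j \in Aint.
  apply: (@root_monic_Aint (map_poly intr P)); last 2 first.
  - exact: monic_map.
  - by apply/polyOverP => k; rewrite coef_map rpred_int.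
  have [Q QE] := dvdpP _ _ dvP.
  have /(congr1 (fun f => (map_poly (ratr : rat -> algC) f).[z ^+ j * r])) := QE.
  rewrite map_comp_poly horner_comp -map_poly_comp (eq_map_poly (ratr_int _)) rootE => ->.
  rewrite rmorphM rmorphB /= map_polyXn map_polyC /= !hornerE rmorph_nat.
  by rewrite exprMn exprAC (prim_expr_order zP) expr1n mul1r rn subrr mulr0.
have sumE : \sum_(j < n) z ^+ (j * (n - i)) * x j = n%:R * ratr g`_i * r ^+ i.
  have xE (j : 'I_n) : z ^+ (j * (n - i)) * x j =
      \sum_(k < n) ratr g`_k * r ^+ k * z ^+ (j * (n - i + k)).
    rewrite /x (horner_coef_wide _ (leq_trans (size_poly _ _) sz_g)) mulr_sumr.
    apply: eq_bigr => k _; rewrite coef_map exprMn mulnDr exprD -exprM.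
    by rewrite /=; ring.
  rewrite (eq_bigr _ (fun j _ => xE j)) exchange_big /= (bigD1 (Ordinal lt_in)) //=.
  rewrite -mulr_sumr sum_prim_root_powers // subnK ?(ltnW lt_in) // dvdnn.
  rewrite big1 ?addr0 => [|k ki]; first by ring.
  rewrite -mulr_sumr sum_prim_root_powers // ifF ?mulr0 //.
  apply/negP => /dvdnP[c cE]; case/negP: ki; apply/eqP/val_inj => /=.
  have := ltn_ord k; move: lt_in cE; clear; move=> /= lt_in cE lt_k.
  by case: c cE => [|[|c]] /=; nia.
have : (n%:R * ratr g`_i * r ^+ i) ^+ n \in Aint.
  rewrite -sumE rpredX // rpred_sum // => j _; apply: rpredM => //.
  by rewrite rpredX // (Aint_prim_root zP).
have -> : (n%:R * ratr g`_i * r ^+ i) ^+ n = ratr ((n%:R * g`_i) ^+ n * M%:R ^+ i).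
  rewrite exprMn exprAC rn; by rewrite !(rmorphM, rmorphXn) /= !rmorph_nat.
move=> xA; rewrite -Cint_rat; apply: Cint_rat_Aint xA.
exact: Crat_rat.
Qed.

(** * Lattices of integer row vectors and their indices *)
Definition row_lattice m n (A : 'M[int]_(m, n)) : set 'rV[int]_n :=
  [set x *m A | x in [set: 'rV[int]_m]].

Lemma row_lattice_unitmxl m n (L : 'M[int]_m) (A : 'M[int]_(m, n)) :
  L \in unitmx -> row_lattice (L *m A) = row_lattice A.
Proof.
move=> uL; apply/seteqP; split=> _ [x _ <-].
  by exists (x *m L) => //; rewrite mulmxA.
by exists (x *m invmx L) => //; rewrite mulmxA mulmxKV.
Qed.

(** H is generated by d Z^n together with its elements having all coordinates in
    [0, |d|), which are finitely many.  The Smith normal form of the matrix of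
    these generators has at most n nonzero rows. *)
Lemma subgroup_row_lattice n (d : int) (H : set 'rV[int]_n) : d != 0 ->
    (forall x y, H x -> H y -> H (x - y)) -> (forall v, H (d *: v)) ->
  exists B : 'M[int]_n, H = row_lattice B.
Proof.
move=> d0 HB Hd.
have H0 : H 0 by rewrite -(scaler0 _ d).
have HN x : H x -> H (- x) by move=> Hx; rewrite -sub0r; apply: HB.
have HD x y : H x -> H y -> H (x + y).
  by move=> Hx Hy; rewrite -[y]opprK; apply/HB/HN.
have HZ (z : int) x : H x -> H (z *: x).
  move=> Hx; have Hn (k : nat) : H (k%:Z *: x).
    elim: k => [|k IH]; first by rewrite scale0r.
    by rewrite intS scalerDl scale1r; apply: HD.
  by case: z => k; [apply: Hn | rewrite NegzE scaleNr; apply/HN/Hn].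
pose T := {ffun 'I_n -> 'I_`|d|}.
pose r (t : T) : 'rV[int]_n := \row_j (t j : nat)%:Z.
pose Q : 'M[int]_(#|T|, n) :=
  \matrix_t (if `[< H (r (enum_val t)) >] then r (enum_val t) else 0).
have HQ t : H (row t Q) by rewrite rowK; case: ifP => // /asboolP.
have -> : H = row_lattice (col_mx d%:M Q).
  apply/seteqP; split=> [v Hv|_ [x _ <-]].
    have lt_mod (j : 'I_n) : (`|modz (v ord0 j) d| < `|d|)%N.
      by rewrite -ltz_nat gez0_abs ?modz_ge0 // ltz_mod.
    pose t : T := [ffun j => Ordinal (lt_mod j)].
    pose u : 'rV[int]_n := \row_j divz (v ord0 j) d.
    have vE : v = d *: u + r t.
      apply/rowP => j; rewrite !mxE ffunE /= gez0_abs ?modz_ge0 //.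
      by rewrite {1}(divz_eq (v ord0 j) d) mulrC.
    have Hr : H (r t) by rewrite -[r t](addKr (d *: u)) -vE addrC; apply/HB.
    exists (row_mx u (delta_mx 0 (enum_rank t))) => //.
    rewrite mul_row_col mul_mx_scalar -rowE rowK enum_rankK.
    by case: asboolP => // _; rewrite -vE.
  rewrite -[x]hsubmxK mul_row_col mul_mx_scalar; apply: (HD) => //.
  rewrite mulmx_sum_row; apply: (big_ind H H0 HD) => i _; exact/HZ/HQ.
have [L uL [R uR [s _ ->]]] := int_Smith_normal_form (col_mx d%:M Q).
set D := \matrix_(_, _) _.
exists (usubmx D *m R).
rewrite -mulmxA row_lattice_unitmxl //.
have D0 : dsubmx D = 0.
  apply/matrixP => i j; rewrite !mxE /= -[X in X == _]/(n + i)%N gtn_eqF //.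
  by rewrite ltn_addr.
have DE (x : 'rV[int]_(n + #|T|)) : x *m (D *m R) = lsubmx x *m (usubmx D *m R).
  rewrite !mulmxA; congr (_ *m _).
  by rewrite -[D in LHS]vsubmxK D0 -[x in LHS]hsubmxK mul_row_col mulmx0 addr0.
apply/seteqP; split=> _ [x _ <-]; first by exists (lsubmx x); rewrite ?DE.
by exists (row_mx x 0); rewrite // DE row_mxKl.
Qed.

(** In the Smith form C = L D R, the rows of R are a basis of Z^n in which the
    sublattice is diagonal.  Each coset then has exactly one representative whose
    i-th coordinate in this basis lies in [0, |d_i|). *)
Lemma add_index_row_lattice n (V : zmodType) (phi : 'rV[int]_n -> V)
    (C : 'M[int]_n) :
  {morph phi : x y / x - y} -> injective phi -> \det C != 0 ->
  add_index (range phi) (phi @` row_lattice C) = `|\det C|%N.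
Proof.
move=> phiB phi_inj detC.
have phi0 : phi 0 = 0 by have := phiB 0 0; rewrite !subrr.
have phiN y : phi (- y) = - phi y by rewrite -(sub0r y) phiB phi0 sub0r.
have phiD x y : phi (x + y) = phi x + phi y by rewrite -{1}(opprK y) phiB phiN opprK.
have [L uL [R uR [s _ CE]]] := int_Smith_normal_form C.
set D := \matrix_(_, _) _ in CE.
pose d (i : 'I_n) := s`_i.
have detD : `|\det C|%N = (\prod_i `|d i|)%N.
  have unit1 (M : 'M[int]_n) : M \in unitmx -> `|\det M|%N = 1%N.
    by rewrite unitmxE => /orP[] /eqP ->.
  rewrite CE !det_mulmx !abszM (unit1 L) // (unit1 R) // mul1n muln1.
  have -> : D = diag_mx (\row_i d i).
    by apply/matrixP => i j; rewrite !mxE.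
  rewrite det_diag (big_morph _ abszM (erefl : `|1%Z|%N = 1%N)).
  by apply: eq_bigr => i _; rewrite mxE.
have d0 i : d i != 0.
  move: detC; rewrite -absz_gt0 detD; apply: contraTneq => di0.
  by rewrite (bigD1 i) //= di0.
have -> : row_lattice C = row_lattice (D *m R) by rewrite CE -mulmxA row_lattice_unitmxl.
pose T := {dffun forall i : 'I_n, 'I_`|d i|}.
pose r (t : T) : 'rV[int]_n := \row_j (t j : nat)%:Z.
pose f (t : T) : set V := [set phi (r t *m R) + h | h in phi @` row_lattice (D *m R)].
have DE (y : 'rV[int]_n) i : (y *m D) 0 i = y 0 i * d i.
  rewrite mxE (bigD1 i) //= mxE eqxx big1 ?addr0 // => j ji.
  by rewrite mxE (_ : (j == i :> nat) = false) ?mulr0 //; apply: negPf ji.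
have f_inj : injective f.
  move=> t t' /seteqP[/(_ (phi (r t *m R)))].
  case=> [|h [_ [y _ <-] <-]].
    by exists 0; rewrite ?addr0 //; exists 0; rewrite ?phi0 //; exists 0; rewrite ?mul0mx.
  rewrite -phiD => /phi_inj; rewrite mulmxA -mulmxDl => /(can_inj (mulmxK uR)) E _.
  apply/ffunP => i; apply: val_inj; apply/eqP; rewrite -eqz_nat; apply/eqP.
  move/matrixP/(_ 0 i) : E; rewrite mxE DE !mxE => E.
  have mod_t (u : T) : ((u i : nat)%:Z %% d i)%Z = (u i : nat)%:Z.
    by rewrite -modz_abs modz_small // ltz_nat ltn_ord.
  by rewrite -(mod_t t) -E addrC modzMDl mod_t.
rewrite /add_index; have -> : cosets (range phi) (phi @` row_lattice (D *m R)) =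
    [set` [fset f t | t in T]%fset].
  apply/seteqP; split.
    move=> _ [_ [v _ <-] <-] /=.
    have [w wE] : exists w, w = v *m invmx R by exists (v *m invmx R).
    have lt_mod (j : 'I_n) : (`|modz (w ord0 j) (d j)| < `|d j|)%N.
      by rewrite -ltz_nat gez0_abs ?modz_ge0 // ltz_mod.
    pose t : T := [ffun j => Ordinal (lt_mod j)].
    pose q : 'rV[int]_n := \row_j divz (w ord0 j) (d j).
    have vE : v = r t *m R + q *m (D *m R).
      rewrite mulmxA -mulmxDl -[LHS](mulmxKV uR) -wE; congr (_ *m _).
      apply/rowP => j; rewrite mxE DE !mxE ffunE /= gez0_abs ?modz_ge0 // addrC.
      exact: divz_eq.
    apply/imfsetP; exists t => //=; apply/seteqP; split=> _ [_ [_ [y _ <-] <-] <-].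
      exists (phi ((q + y) *m (D *m R))).
        by exists ((q + y) *m (D *m R)) => //; exists (q + y).
      by rewrite vE mulmxDl !phiD addrA.
    exists (phi ((y - q) *m (D *m R))).
      by exists ((y - q) *m (D *m R)) => //; exists (y - q).
    by rewrite vE mulmxBl !phiD phiN addrACA addrN addr0 addrC.
  move=> _ /imfsetP[t _ ->] /=.
  by exists (phi (r t *m R)) => //; exists (r t *m R).
rewrite set_fsetK card_imfset //= -cardE card_dep_ffun detD foldrE big_image /=.
by apply: eq_bigr => i _; rewrite card_ord.
Qed.

(** * Primitive elements of a number field *)
Lemma irreducible_pure (p q n : nat) : prime p -> prime q -> p != q -> (1 < n)%N ->
  irreducible_poly ('X^n - (p * q ^ n.-1)%:R%:P : {poly rat}).
Proof.
move=> p_pr q_pr pq n_gt1; have n_gt0 := ltnW n_gt1.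
pose f : {poly int} := 'X^n - (p * q ^ n.-1)%:Z%:P.
have -> : 'X^n - (p * q ^ n.-1)%:R%:P = map_poly intr f :> {poly rat}.
  by rewrite rmorphB /= map_polyXn map_polyC.
apply/irreducible_rat_int; apply: (eisenstein_crit p_pr).
- by rewrite size_XnsubC // gtn_eqF.
- by rewrite lead_coefXnsubC // dvdz1 /= gtn_eqF // prime_gt1.
- rewrite coefB coefXn coefC eq_sym gtn_eqF //= sub0r rpredN.
  rewrite -[_ \in _]/((p%:Z ^+ 2 %| (p * q ^ n.-1)%:Z)%Z) dvdzE abszX !absz_nat.
  rewrite expnS expn1 dvdn_pmul2l ?prime_gt0 //.
  by rewrite Euclid_dvdX // dvdn_prime2 // (negPf pq).
- move=> i; rewrite size_XnsubC // => lt_in.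
  rewrite coefB coefXn coefC (ltn_eqF lt_in) sub0r rpredN.
  by case: (i == 0%N); [apply: (dvdn_mulr _ (dvdnn p)) | apply: dvdz0].
Qed.

Lemma exists_pure_field (p q n : nat) : prime p -> prime q -> p != q -> (1 < n)%N ->
  exists (K : fieldExtType rat) (a : K),
    [/\ \dim {:K} = n, <<1; a>>%VS = fullv & a ^+ n = (p * q ^ n.-1)%:R].
Proof.
move=> p_pr q_pr pq n_gt1.
have [K dimK [a ra genK]] := irredp_FAdjoin (irreducible_pure p_pr q_pr pq n_gt1).
exists K, a; split=> //; first by rewrite dimK size_XnsubC // ltnW.
move: ra; rewrite rootE rmorphB /= map_polyXn map_polyC /= !hornerE scaler_nat subr_eq0.
by move/eqP.
Qed.

Section PrimitiveElement.
Variables (K : fieldExtType rat) (a : K).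
Hypothesis genK : <<1; a>>%VS = fullv.

Lemma adjoin_degree_primitive : adjoin_degree 1 a = \dim {:K}.
Proof. by have := dim_Fadjoin 1 a; rewrite genK dimv1 muln1. Qed.

Lemma horner_alg_inj (g : {poly rat}) :
  (size g <= \dim {:K})%N -> horner_alg a g = 0 -> g = 0.
Proof.
move=> sz_g g0; apply/eqP; rewrite -(map_poly_eq0 (in_alg K)).
apply: contraTT isT => nz.
have : minPoly 1 a %| map_poly (in_alg K) g.
  by apply: minPoly_dvdp; [apply/polyOver1P; exists g | rewrite rootE; apply/eqP].
move/(dvdp_leq nz); rewrite size_minPoly adjoin_degree_primitive size_map_poly.
by rewrite leqNgt ltnS sz_g.
Qed.

Lemma horner_alg_surj (x : K) :
  exists2 g : {poly rat}, (size g <= \dim {:K})%N & x = horner_alg a g.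
Proof.
have /polyOver1P[g gE] := Fadjoin_polyOver 1 a x.
exists g.
  by rewrite -(size_map_poly (in_alg K)) -gE -adjoin_degree_primitive size_Fadjoin_poly.
by rewrite /horner_alg /horner_morph -gE Fadjoin_poly_eq // genK memvf.
Qed.

Lemma horner_alg_int (f : {poly int}) :
  horner_alg a (map_poly intr f) = (map_poly intr f).[a].
Proof.
rewrite /horner_alg /horner_morph -map_poly_comp; congr _.[_].
by apply: eq_map_poly => z; apply: (rmorph_int (in_alg K)).
Qed.

(** By Gauss's lemma an integer multiple of the minimal polynomial divides a monic
    integer polynomial within Z[X].  Its leading coefficient is thus 1 or -1, and
    multiplying by it gives a monic polynomial. *)
Lemma integral_monic_minpoly : ring_of_integers a ->
  exists p : {poly int},
    [/\ p \is monic, size p = (\dim {:K}).+1 & (map_poly intr p).[a] = 0].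
Proof.
case=> P Pmon; rewrite rootE -horner_alg_int => /eqP Pa.
have /polyOver1P[mu muE] := minPolyOver 1 a.
have mu_P : mu %| map_poly intr P.
  rewrite -(dvdp_map (in_alg K)) -muE; apply: minPoly_dvdp; last by apply/eqP.
  by apply/polyOver1P; exists (map_poly intr P).
have sz_mu : size mu = (\dim {:K}).+1.
  by rewrite -(size_map_poly (in_alg K)) -muE size_minPoly adjoin_degree_primitive.
have mu_a : horner_alg a mu = 0 by rewrite /horner_alg /horner_morph -muE minPolyxx.
have [p1 [c c0 muE'] [r PE]] := dvdpP_rat_int mu_P.
have sz_p1 : size p1 = (\dim {:K}).+1.
  by rewrite -sz_mu muE' size_scale // size_rat_int_poly.
have p1_a : horner_alg a (map_poly intr p1) = 0.
  apply/eqP; move/eqP: mu_a; rewrite muE' -mul_polyC rmorphM /= mulf_eq0 horner_algC.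
  by rewrite scaler_eq0 (negPf c0) oner_eq0.
have l1 : lead_coef p1 * lead_coef p1 = 1.
  have /eqP := monicP Pmon; rewrite PE lead_coefM => /eqP l1.
  by have /orP[] := intUnitRing.unitzPl (etrans (mulrC _ _) l1) => /eqP ->.
exists (lead_coef p1 *: p1); split.
- by rewrite monicE lead_coefZ l1.
- rewrite size_scale // -?sz_p1 // lead_coef_eq0 -size_poly_eq0 sz_p1 //.
- by rewrite -horner_alg_int map_polyZ -mul_polyC rmorphM /= p1_a mulr0.
Qed.

(** Euclidean division by the monic minimal polynomial brings every integer
    polynomial in a below degree n. *)
Lemma int_adjoin_lattice n : \dim {:K} = n -> ring_of_integers a ->
  int_adjoin a =
    [set horner_alg a (rVpoly (map_mx (intr : int -> rat) x)) | x in [set: 'rV[int]_n]].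
Proof.
move=> dimK /integral_monic_minpoly[p [p_mon sz_p pa]].
have E (x : 'rV[int]_n) : rVpoly (map_mx (intr : int -> rat) x) = map_poly intr (rVpoly x).
  apply/polyP => i; rewrite coef_map !coef_rVpoly.
  by case: insubP => [j _ _|_]; rewrite ?mxE.
apply/seteqP; split=> _ [f _ <-].
  exists (poly_rV (f %% p)) => //.
  rewrite E poly_rV_K; last by rewrite -ltnS -dimK -sz_p ltn_modp monic_neq0.
  rewrite horner_alg_int {2}(Pdiv.IdomainMonic.divp_eq p_mon f).
  by rewrite rmorphD rmorphM /= hornerD hornerM pa mulr0 add0r.
by exists (rVpoly f); rewrite // E horner_alg_int.
Qed.

End PrimitiveElement.

(** * The integers of a pure field *)
Section PureField.
Variables (p q n : nat) (K : fieldExtType rat) (a : K).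
Hypotheses (p_pr : prime p) (q_pr : prime q) (pq : p != q) (n_gt1 : (1 < n)%N).
Hypotheses (dimK : \dim {:K} = n) (genK : <<1; a>>%VS = fullv).
Hypothesis (an : a ^+ n = (p * q ^ n.-1)%:R).

Let n_gt0 : (0 < n)%N := ltnW n_gt1.

Lemma dvdp_pure (f : {poly rat}) : horner_alg a f = 0 ->
  'X^n - (p * q ^ n.-1)%:R%:P %| f.
Proof.
set u := 'X^n - _ => f0.
have u_mon : u \is monic by apply: monicXnsubC.
have sz_u : size u = n.+1 by apply: size_XnsubC.
rewrite /dvdp -/(f %% u); apply/eqP/(horner_alg_inj genK).
  by rewrite dimK -ltnS -sz_u ltn_modp monic_neq0.
have u0 : horner_alg a u = 0.
  by rewrite rmorphB rmorphXn /= horner_algX horner_algC an scaler_nat subrr.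
by move: f0; rewrite {1}(divp_eq f u) rmorphD rmorphM /= u0 mulr0 add0r.
Qed.

(** In other words n times the ring of integers is contained in the lattice
    spanned by 1 and the a^i / q^(i-1). *)
Lemma integral_coef (g : {poly rat}) : (size g <= n)%N ->
  ring_of_integers (horner_alg a g) ->
  forall i, (i < n)%N -> n%:R * g`_i * (q ^ i.-1)%:R \is a Num.int.
Proof.
move=> sz_g [P Pmon rP] i lt_in.
apply: (int_pure_radical p_pr q_pr pq lt_in).
apply: (@integral_coef_pure_radical _ _ _ P) => //.
apply: dvdp_pure; apply/eqP; move: rP; rewrite rootE.
suff -> : (map_poly intr P).[horner_alg a g] = horner_alg a (map_poly intr P \Po g) by [].
rewrite [in RHS]/horner_alg /horner_morph map_comp_poly horner_comp; congr _.[_].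
rewrite -map_poly_comp; apply: eq_map_poly => z; apply/esym/(rmorph_int (in_alg K)).
Qed.

(** Over the powers of a, the coordinates of the integers a^i / q^(i-1), and of 1
    for i = 0, where i.-1 is 0. *)
Definition radical_scale : 'M[rat]_n := diag_mx (\row_i ((q ^ i.-1)%:R)^-1).

(** For i > 0 the n-th power of a^i / q^(i-1) is p^i q^(n-i). *)
Lemma integral_radical_scale (v : 'rV[int]_n) :
  ring_of_integers (horner_alg a (rVpoly (map_mx intr v *m radical_scale))).
Proof.
have q0 : q%:R != 0 :> K by rewrite -(rmorph_nat (in_alg K)) fmorph_eq0 pnatr_eq0 -lt0n prime_gt0.
have -> : horner_alg a (rVpoly (map_mx intr v *m radical_scale)) =
    \sum_(i < n) (v 0 i)%:~R * (a ^+ i / (q ^ i.-1)%:R).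
  have -> : rVpoly (map_mx intr v *m radical_scale) =
     \sum_(i < n) ((v 0 i)%:~R / (q ^ i.-1)%:R)%:P * 'X^i.
    rewrite /rVpoly poly_def; apply: eq_bigr => i _.
    by rewrite valK mul_mx_diag !mxE mul_polyC.
  rewrite rmorph_sum; apply: eq_bigr => i _.
  rewrite rmorphM (rmorphXn (horner_alg a)) /= horner_algX horner_algC.
  have -> : ((v 0 i)%:~R / (q ^ i.-1)%:R)%:A = (v 0 i)%:~R / (q ^ i.-1)%:R :> K.
    by rewrite -[LHS]/(in_alg K _) fmorph_div rmorph_int rmorph_nat.
  by rewrite mulrAC mulrA.
apply: (big_ind (fun x : K => integralOver (intr : int -> K) x)).
- exact: integral0.
- by move=> x y; apply: integral_add.
move=> i _; apply: integral_mul; first exact: integral_id.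
exists ('X^n - (p ^ i * q ^ (if i == 0 :> nat then 0 else n - i))%N%:Z%:P).
  exact: monicXnsubC.
rewrite rootE rmorphB /= map_polyXn map_polyC /= !hornerE subr_eq0.
rewrite expr_div_n exprAC an -natrX -[X in _ == X]/(_%:R) -!natrX.
rewrite (can2_eq (divfK _) (mulfK _)) ?natrX ?expf_neq0 //.
rewrite -!natrX -natrM expnMn -mulnA; apply/eqP; congr (_ * _)%:R.
rewrite -!expnM -expnD; congr (_ ^ _)%N.
have := ltn_ord i; move: n_gt0; clear; case: eqP => [->|]; nia.
Qed.

(** The rows of B are read over the basis formed by 1 / n and the
    a^i / (n q^(i-1)). *)
Definition integer_lattice_mx (B : 'M[int]_n) : 'M[rat]_n :=
  n%:R^-1 *: (map_mx intr B *m radical_scale).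

Definition lattice_point (P : 'M[rat]_n) (x : 'rV[int]_n) : K :=
  horner_alg a (rVpoly (map_mx intr x *m P)).

Lemma lattice_pointB (P : 'M[rat]_n) x y :
  lattice_point P (x - y) = lattice_point P x - lattice_point P y.
Proof. by rewrite /lattice_point map_mxB mulmxBl linearB rmorphB. Qed.

(** Let L be the lattice spanned by 1 and the a^i / q^(i-1), and O the ring of
    integers.  Then n O is a subgroup of L that contains n L, so that it is the
    row lattice of some B over the basis of L.  As n L is contained in it, E B = n
    for an integer matrix E, and det B divides n^n. *)
Lemma ring_of_integers_lattice : exists B : 'M[int]_n,
  [/\ \det B != 0, (`|\det B| <= n ^ n)%N &
      ring_of_integers (K := K) = range (lattice_point (integer_lattice_mx B))].
Proof.
have n0 : n%:R != 0 :> rat by rewrite pnatr_eq0 -lt0n.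
pose H : set 'rV[int]_n :=
  [set v | ring_of_integers (lattice_point (n%:R^-1 *: radical_scale) v)].
have Hn (v : 'rV[int]_n) : H (n%:Z *: v).
  have := integral_radical_scale v; rewrite /H /= /lattice_point map_mxZ /= -scalemxAr -scalemxAl.
  by rewrite scalerA mulVf // scale1r.
have HB x y : H x -> H y -> H (x - y).
  by rewrite /H /= lattice_pointB; apply: integral_sub.
have nZ0 : n%:Z != 0 by rewrite eqz_nat -lt0n.
have [B HE] := subgroup_row_lattice nZ0 HB Hn.
have [E EB] : exists E : 'M[int]_n, E *m B = n%:Z%:M.
  have in_B (i : 'I_n) : exists x : 'rV[int]_n, x *m B = n%:Z *: delta_mx 0 i.
    by have := Hn (delta_mx 0 i); rewrite HE => -[x _ xE]; exists x.
  have [f fE] := fin_all_exists in_B.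
  exists (\matrix_i f i); apply/row_matrixP => i; rewrite row_mul rowK fE.
  by rewrite rowE mul_mx_scalar.
have detEB : \det E * \det B = (n ^ n)%N%:Z.
  by rewrite -det_mulmx EB det_scalar -!natz natrX.
have absEB : (`|\det E| * `|\det B|)%N = (n ^ n)%N by rewrite -abszM detEB.
have nn_gt0 : (0 < n ^ n)%N by rewrite expn_gt0 n_gt0.
have PB (x : 'rV[int]_n) :
    lattice_point (integer_lattice_mx B) x = lattice_point (n%:R^-1 *: radical_scale) (x *m B).
  by rewrite /lattice_point /integer_lattice_mx map_mxM -!scalemxAr mulmxA.
exists B; split.
- by rewrite -absz_gt0; move: nn_gt0; rewrite -absEB muln_gt0 => /andP[].
- by apply: dvdn_leq => //; rewrite -absEB dvdn_mull.
apply/seteqP; split=> [x xint|_ [y _ <-]]; last first.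
  by rewrite PB; suff : H (y *m B) by []; rewrite HE; exists y.
have [g sz_g xE] := horner_alg_surj genK x; rewrite dimK in sz_g.
have gZ (i : 'I_n) : exists z : int, n%:R * g`_i * (q ^ i.-1)%:R = z%:~R.
  by apply/intrP; apply: integral_coef => //; rewrite -xE.
have [f fE] := fin_all_exists gZ.
pose v : 'rV[int]_n := \row_i f i.
have vx : lattice_point (n%:R^-1 *: radical_scale) v = x.
  rewrite xE /lattice_point; congr horner_alg; rewrite -[RHS](poly_rV_K sz_g); congr rVpoly.
  apply/rowP => i; rewrite -scalemxAr mul_mx_diag !mxE -fE.
  have qi0 : (q ^ i.-1)%:R != 0 :> rat by rewrite pnatr_eq0 -lt0n expn_gt0 prime_gt0.
  by rewrite mulfK // mulKf.
have : H v by rewrite /H /= vx.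
by rewrite HE => -[y _ yE]; exists y => //; rewrite PB yE.
Qed.

(** * The index of the powers of a primitive integer *)
Lemma horner_alg_rVpoly (c : K) (u : 'rV[rat]_n) :
  horner_alg c (rVpoly u) = \sum_(i < n) u 0 i *: c ^+ i.
Proof.
rewrite /rVpoly poly_def rmorph_sum; apply: eq_bigr => i _.
by rewrite valK -mul_polyC rmorphM (rmorphXn (horner_alg c)) /= horner_algX horner_algC mulr_algl.
Qed.

Lemma horner_alg_change_basis (b : K) (A : 'M[rat]_n) :
  (forall j : 'I_n, b ^+ j = horner_alg a (rVpoly (row j A))) ->
  forall u : 'rV[rat]_n, horner_alg b (rVpoly u) = horner_alg a (rVpoly (u *m A)).
Proof.
move=> AE u; rewrite horner_alg_rVpoly mulmx_sum_row.
rewrite (linear_sum rVpoly) rmorph_sum; apply: eq_bigr => j _.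
by rewrite linearZ /= -mul_polyC rmorphM /= horner_algC mulr_algl AE.
Qed.

Lemma det_power_matrix_neq0 (b : K) (A : 'M[rat]_n) : <<1; b>>%VS = fullv ->
  (forall j : 'I_n, b ^+ j = horner_alg a (rVpoly (row j A))) -> \det A != 0.
Proof.
move=> genb /horner_alg_change_basis bA; apply/negP => /det0P[u u0 uA].
case/negP: u0; apply/eqP; rewrite -[u]rVpolyK.
rewrite (horner_alg_inj genb (_ : (size (rVpoly u) <= _)%N)) ?linear0 //.
  by rewrite dimK size_poly.
by rewrite bA uA linear0 rmorph0.
Qed.

(** The rows of C are the coordinates of the powers of b over a basis of the
    integers, which makes its determinant the index up to sign; the rows of A are
    their coordinates over the powers of a. *)
Lemma index_matrix (B : 'M[int]_n) (b : K) :
    ring_of_integers (K := K) = range (lattice_point (integer_lattice_mx B)) ->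
    ring_of_integers b -> <<1; b>>%VS = fullv ->
  exists (C : 'M[int]_n) (A : 'M[rat]_n),
    [/\ \det C != 0, add_index (ring_of_integers (K := K)) (int_adjoin b) = `|\det C|%N,
        A = map_mx intr C *m integer_lattice_mx B &
        forall j : 'I_n, b ^+ j = horner_alg a (rVpoly (row j A))].
Proof.
set P := integer_lattice_mx B => OE b_int genb.
have bX (j : 'I_n) : exists x, b ^+ j = lattice_point P x.
  have : ring_of_integers (b ^+ j).
    elim: (j : nat) => [|k IH]; first exact: (integral1 (intr : int -> K)).
    by rewrite exprS; apply: integral_mul.
  by rewrite OE => -[x _ <-]; exists x.
have [f fE] := fin_all_exists bX.
pose C := \matrix_j f j.
have AE (j : 'I_n) : b ^+ j = horner_alg a (rVpoly (row j (map_mx intr C *m P))).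
  by rewrite row_mul -map_row rowK fE.
have := det_power_matrix_neq0 genb AE; rewrite det_mulmx mulf_eq0 => /norP[detC detP].
rewrite det_map_mx intr_eq0 in detC.
exists C, (map_mx intr C *m P); split=> //.
rewrite (int_adjoin_lattice genb dimK b_int) OE.
have -> : [set horner_alg b (rVpoly (map_mx (intr : int -> rat) x)) | x in [set: 'rV[int]_n]] =
    lattice_point P @` row_lattice C.
  have E x : horner_alg b (rVpoly (map_mx (intr : int -> rat) x)) = lattice_point P (x *m C).
    by rewrite (horner_alg_change_basis AE) /lattice_point map_mxM mulmxA.
  apply/seteqP; split=> [_ [x _ <-]|_ [_ [x _ <-] <-]]; last by exists x.
  by exists (x *m C); [exists x | rewrite E].
apply: add_index_row_lattice => //; first exact: lattice_pointB.
have inj0 x : lattice_point P x = 0 -> x = 0.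
  move/(horner_alg_inj genK); rewrite dimK => /(_ (size_poly _ _)) x0.
  have : map_mx intr x *m P = 0 by rewrite -[LHS]rVpolyK x0 linear0.
  move/(congr1 (mulmx^~ (invmx P))); rewrite mulmxK ?unitmxE ?unitfE // mul0mx.
  by move/matrixP => xE; apply/matrixP => i j; move: (xE i j); rewrite !mxE => /eqP;
    rewrite intr_eq0 => /eqP.
by move=> x y xy; apply/eqP; rewrite -subr_eq0; apply/eqP/inj0; rewrite lattice_pointB xy subrr.
Qed.

Lemma det_integer_lattice_mx (B : 'M[int]_n) :
  n%:R ^+ n * q%:R ^+ 'C(n.-1, 2) * \det (integer_lattice_mx B) = (\det B)%:~R.
Proof.
have n0 : n%:R != 0 :> rat by rewrite pnatr_eq0 -lt0n.
have q0 : q%:R != 0 :> rat by rewrite pnatr_eq0 -lt0n prime_gt0.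
have detW : \det (radical_scale) = q%:R ^- 'C(n.-1, 2).
  rewrite det_diag -triangular_sum.
  transitivity (\prod_(i < n) (q%:R : rat) ^- i.-1).
    by apply: eq_bigr => i _; rewrite mxE natrX.
  rewrite -exprVn -prodrXr -(prednK n_gt0) big_ord_recl /= expr0 invr1 mul1r big_mkord.
  by apply: eq_bigr => i _; rewrite exprVn.
rewrite detZ det_mulmx det_map_mx detW exprVn.
by field; rewrite !expf_neq0.
Qed.

(** The integer t is the determinant of the remainders of the powers of h by
    X^n - p q^(n-1).  Modulo p this divisor is X^n, so that the remainders are
    plain truncations and [det_coef_powers] applies. *)
Lemma det_powers_mod_p (b : K) (A : 'M[rat]_n) (h : {poly int}) (k : nat) :
    (forall j : 'I_n, b ^+ j = horner_alg a (rVpoly (row j A))) ->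
    horner_alg a (map_poly intr h) = k%:R * b ->
  exists2 t : int, k%:R ^+ 'C(n, 2) * \det A = t%:~R &
    t%:~R = (h`_1)%:~R ^+ 'C(n, 2) :> 'F_p.
Proof.
move=> AE hE.
pose f : {poly int} := 'X^n - (p * q ^ n.-1)%:Z%:P.
have f_mon : f \is monic by apply: monicXnsubC.
have sz_f : size f = n.+1 by apply: size_XnsubC.
have f0 : horner_alg a (map_poly intr f) = 0.
  rewrite rmorphB /= map_polyXn map_polyC rmorphB (rmorphXn (horner_alg a)) /=.
  by rewrite horner_algX horner_algC an scaler_nat subrr.
pose T : 'M[int]_n := \matrix_(j, i) (h ^+ j %% f)`_i.
have TA : map_mx intr T = diag_mx (\row_j k%:R ^+ j) *m A.
  apply/row_matrixP => j.
  have -> : row j (diag_mx (\row_j k%:R ^+ j) *m A) = k%:R ^+ j *: row j A.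
    by apply/rowP => i; rewrite mul_diag_mx !mxE.
  have sz_r : (size (map_poly (intr : int -> rat) (h ^+ j %% f)) <= n)%N.
    by rewrite size_rat_int_poly -ltnS -sz_f ltn_modp monic_neq0.
  have -> : row j (map_mx intr T) = poly_rV (map_poly intr (h ^+ j %% f)) :> 'rV[rat]_n.
    by apply/rowP => i; rewrite !mxE coef_map.
  apply: (can_inj rVpolyK); rewrite poly_rV_K //; apply/eqP; rewrite -subr_eq0; apply/eqP.
  apply: (horner_alg_inj genK).
    by rewrite dimK (leq_trans (size_polyD _ _)) // geq_max sz_r size_polyN size_poly.
  rewrite linearZ /= -mul_polyC rmorphB rmorphM /= horner_algC -AE.
  have : horner_alg a (map_poly intr (h ^+ j)) = k%:R ^+ j * b ^+ j.
    by rewrite rmorphXn (rmorphXn (horner_alg a)) /= hE exprMn.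
  rewrite (Pdiv.IdomainMonic.divp_eq f_mon (h ^+ j)) rmorphD !rmorphM rmorphD rmorphM /=.
  rewrite f0 mulr0 add0r -(Pdiv.IdomainMonic.divp_eq f_mon) => ->.
  by rewrite -[X in X%:A]natrX scaler_nat natrX subrr.
exists (\det T).
  rewrite -det_map_mx TA det_mulmx det_diag -triangular_sum big_mkord -prodrXr.
  by congr (_ * _); apply: eq_bigr => j _; rewrite mxE.
rewrite -det_map_mx -coef_map -det_coef_powers; congr (\det _).
apply/matrixP => j i; rewrite !mxE -rmorphXn coef_map /=.
rewrite {2}(Pdiv.IdomainMonic.divp_eq f_mon (h ^+ j)).
rewrite coefD /f mulrBr coefB coefMXn ltn_ord.
have M0 : (p * q ^ n.-1)%N%:Z%:~R = 0 :> 'F_p.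
  by rewrite -[LHS]/((p * q ^ n.-1)%:R) natrM pchar_Fp_0 // mul0r.
by rewrite coefMC sub0r rmorphD rmorphN /= intrM M0 mulr0 oppr0 add0r.
Qed.

End PureField.

(** * A field all of whose indices are large *)
Lemma bin2_pred_bounds n : (2 < n)%N -> (0 < 'C(n.-1, 2) < 'C(n, 2))%N.
Proof.
case: n => [|[|[|n]]] //= _.
by rewrite bin_gt0 /= [X in (_ < X)%N]binS bin1 -addn1 leq_add2l.
Qed.

Lemma small_intr_is_power p m X (z : int) :
  (forall k, (k <= X)%N -> is_power m (k%:R : 'F_p)) -> is_power m (-1 : 'F_p) ->
  (`|z| <= X)%N -> is_power m (z%:~R : 'F_p).
Proof.
move=> powk powN1; case: z => k kX; first exact: powk.
by rewrite NegzE rmorphN -mulN1r; apply: is_powerM => //; apply: powk.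
Qed.

Lemma small_intr_neq0 p (z : int) : prime p -> (`|z| < p)%N -> z != 0 -> z%:~R != 0 :> 'F_p.
Proof.
move=> p_pr zp z0; rewrite Fp_intr_eq0 //; apply/negP => /dvdn_leq.
by rewrite absz_gt0 z0 => /(_ isT); rewrite leqNgt zp.
Qed.

(** If the index of b were at most N, then in the congruence
    n^n q^e h_1^m = k^m * det C * det B modulo p every factor other than q^e would
    be a nonzero m-th power. *)
Lemma exists_field_large_indices (n N : nat) : (2 < n)%N ->
  exists K : fieldExtType rat,
    [/\ \dim {:K} = n,
        exists2 a : K, ring_of_integers a & <<1; a>>%VS = fullv &
        forall b : K, ring_of_integers b -> <<1; b>>%VS = fullv ->
          (N < add_index (ring_of_integers (K := K)) (int_adjoin b))%N].
Proof.
move=> n_gt2; have n_gt1 := ltnW n_gt2; have n_gt0 := ltnW n_gt1.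
set m := 'C(n, 2); set e := 'C(n.-1, 2).
have [p [q [[p_pr q_pr lt_qp Xq] [powk powN1 not_pow]]]] :=
  exists_good_primes (maxn N (n ^ n)) (bin2_pred_bounds n_gt2).
have pq : p != q by rewrite gtn_eqF.
have [K [a [dimK genK an]]] := exists_pure_field p_pr q_pr pq n_gt1.
exists K; split=> //.
  exists a => //; exists ('X^n - (p * q ^ n.-1)%:Z%:P); first exact: monicXnsubC.
  by rewrite rootE rmorphB /= map_polyXn map_polyC /= !hornerE an subrr.
move=> b b_int genb; rewrite ltnNge; apply/negP => idx_le.
have [B [detB0 detB_le OE]] := ring_of_integers_lattice p_pr q_pr pq n_gt1 dimK genK an.
have [C [A [detC0 idxE AE bA]]] := index_matrix dimK genK OE b_int genb.
rewrite idxE in idx_le.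
(* since n g_i q^(i-1) is an integer for each i < n, so is n q^n g_i *)
have [k kE] : exists k, k = (n * q ^ n)%N by eexists.
have [g sz_g bE] := horner_alg_surj genK b; rewrite dimK in sz_g.
have kgZ : k%:R *: g \is a polyOver Num.int.
  apply/polyOverP => i; rewrite coefZ; have [lt_in|le_ni] := ltnP i n; last first.
    by rewrite nth_default ?mulr0 // (leq_trans sz_g).
  have gi := integral_coef p_pr q_pr pq n_gt1 dimK genK an sz_g _ lt_in.
  rewrite bE in b_int; move/(_ b_int): gi => gi.
  have -> : k%:R * g`_i = n%:R * g`_i * (q ^ i.-1)%:R * (q ^ (n - i.-1))%:R.
    rewrite -[RHS]mulrA -natrM -expnD subnKC ?(leq_trans (leq_pred i) (ltnW lt_in)) //.
    by rewrite kE natrM mulrAC.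
  by rewrite rpredM // rpred_nat.
have [h hE] := floorpP kgZ.
have h_kb : horner_alg a (map_poly intr h) = k%:R * b.
  by rewrite -hE -mul_polyC rmorphM /= horner_algC scaler_nat -bE.
have [t tA tp] := det_powers_mod_p p_pr n_gt1 dimK genK an bA h_kb.
have detP := det_integer_lattice_mx q_pr n_gt1 B.
have tE : n%:Z ^+ n * q%:Z ^+ e * t = k%:Z ^+ m * \det C * \det B.
  apply: (@intr_inj rat); rewrite !rmorphM !rmorphXn /= -tA -detP AE det_mulmx det_map_mx.
  by rewrite /= -/m -/e; move: (\det (integer_lattice_mx q B)) => D; ring.
pose F := 'F_p.
have lt_Xp : (maxn N (n ^ n) < p)%N by apply: ltn_trans lt_qp.
have le_nX : (n <= maxn N (n ^ n))%N.
  by rewrite leq_max; apply/orP; right; rewrite -{1}[n]expn1 leq_pexp2l.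
have powz := small_intr_is_power powk powN1.
have neq0 (z : int) : z != 0 -> (`|z| <= maxn N (n ^ n))%N -> z%:~R != 0 :> F.
  by move=> z0 zX; apply: small_intr_neq0 => //; apply: leq_ltn_trans lt_Xp.
have CX : (`|\det C| <= maxn N (n ^ n))%N by rewrite leq_max idx_le.
have BX : (`|\det B| <= maxn N (n ^ n))%N by rewrite leq_max detB_le orbT.
have n0 : n%:R != 0 :> F by apply: (neq0 n) => //; rewrite eqz_nat -lt0n.
have q0 : q%:R != 0 :> F.
  by apply: (@small_intr_neq0 p q p_pr lt_qp); rewrite eqz_nat -lt0n prime_gt0.
have modE : n%:R ^+ n * q%:R ^+ e * (h`_1)%:~R ^+ m =
    k%:R ^+ m * (\det C)%:~R * (\det B)%:~R :> F.
  have /(congr1 (fun z : int => z%:~R : F)) := tE.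
  by rewrite !rmorphM !rmorphXn /= tp.
have rhs0 : k%:R ^+ m * (\det C)%:~R * (\det B)%:~R != 0 :> F.
  by rewrite !mulf_neq0 ?neq0 // kE natrM natrX expf_neq0 // mulf_neq0 ?expf_neq0.
have h0 : (h`_1)%:~R ^+ m != 0 :> F.
  by apply: contraNneq rhs0 => h0; rewrite -modE h0 mulr0.
apply: not_pow.
have -> : q%:R ^+ e = k%:R ^+ m * (\det C)%:~R * (\det B)%:~R
    * ((n%:R ^+ n)^-1 * ((h`_1)%:~R ^+ m)^-1) :> F.
  by rewrite -modE; field; rewrite h0 expf_neq0.
apply: is_powerM; [apply: is_powerM; [apply: is_powerM|]|apply: is_powerM].
- by exists k%:R.
- exact: powz.
- exact: powz.
- exact/is_powerV/is_powerX/powk.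
- by apply: is_powerV; exists (h`_1)%:~R.
Qed.

(** * The minimal index *)
Lemma card_fset_set_image (T U : choiceType) (f : T -> U) (A : set T) :
  injective f -> #|` fset_set (f @` A)|%fset = #|` fset_set A|%fset.
Proof.
move=> f_inj; have fA : (f @` A #= A)%card by apply: inj_card_eq => x y _ _; apply: f_inj.
have [finA|infA] := pselect (finite_set A).
  have [k Ak] := (finite_setP A).1 finA.
  by rewrite (card_fset_set Ak) (card_fset_set (card_eq_trans fA Ak)).
rewrite /fset_set; case: pselect => [finfA|_]; last by case: pselect.
by case: infA; rewrite -(eq_finite_set fA).
Qed.

Lemma add_index_image (V W : zmodType) (f : {additive V -> W}) (G H : set V) :
  injective f -> add_index (f @` G) (f @` H) = add_index G H.
Proof.
move=> f_inj; rewrite /add_index.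
have -> : cosets (f @` G) (f @` H) = (fun S : set V => f @` S) @` cosets G H.
  have E x : [set f x + h | h in f @` H] = f @` [set x + h | h in H].
    apply/seteqP; split=> [_ [_ [h Hh <-] <-]|_ [_ [h Hh <-] <-]].
      by exists (x + h); [exists h | rewrite raddfD].
    by exists (f h); [exists h | rewrite raddfD].
  apply/seteqP; split=> [_ [_ [x Gx <-] <-]|_ [_ [x Gx <-] <-]].
    by rewrite E; exists [set x + h | h in H] => //; exists x.
  by rewrite -E; exists (f x) => //; exists x.
apply: card_fset_set_image => A B AB; apply/seteqP; split=> x Ax.
  have : (f @` B) (f x) by rewrite -AB; exists x.
  by case=> y By /f_inj <-.
have : (f @` A) (f x) by rewrite AB; exists x.
by case=> y By /f_inj <-.
Qed.

Section FieldMorphism.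
Variables (K L : fieldExtType rat) (f : {rmorphism K -> L}).

Lemma rmorph_horner_int (P : {poly int}) (x : K) :
  f (map_poly intr P).[x] = (map_poly intr P).[f x].
Proof.
rewrite -horner_map -map_poly_comp; congr _.[_].
by apply: eq_map_poly => z /=; rewrite rmorph_int.
Qed.

Lemma rmorph_ring_of_integers (x : K) : ring_of_integers (f x) <-> ring_of_integers x.
Proof.
by split=> -[P Pmon rP]; exists P => //; move: rP; rewrite !rootE -rmorph_horner_int fmorph_eq0.
Qed.

Lemma rmorph_horner_alg (x : K) (g : {poly rat}) : f (horner_alg x g) = horner_alg (f x) g.
Proof.
rewrite /horner_alg /horner_morph -horner_map -map_poly_comp; congr _.[_].
by apply: eq_map_poly => z /=; rewrite !alg_num_field fmorph_rat.
Qed.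

Hypothesis f_bij : bijective f.

Lemma rmorph_primitive (x : K) : <<1; f x>>%VS = fullv <-> <<1; x>>%VS = fullv.
Proof.
have gen (M : fieldExtType rat) (z : M) :
    (forall y, exists g, y = horner_alg z g) -> <<1; z>>%VS = fullv.
  move=> zgen; apply/eqP; rewrite eqEsubv subvf; apply/subvP => y _.
  by have [g ->] := zgen y; apply: mempx_Fadjoin; apply/polyOver1P; exists g.
have [f' fK f'K] := f_bij.
split=> genx; apply: gen => y.
  have [g _ fy] := horner_alg_surj genx (f y).
  by exists g; apply: (can_inj fK); rewrite rmorph_horner_alg.
have [g _ f'y] := horner_alg_surj genx (f' y).
by exists g; rewrite -rmorph_horner_alg -f'y f'K.
Qed.

Lemma add_index_int_adjoin_rmorph (x : K) :
  add_index (ring_of_integers (K := L)) (int_adjoin (f x)) =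
  add_index (ring_of_integers (K := K)) (int_adjoin x).
Proof.
rewrite -(@add_index_image K L f _ _ (bij_inj f_bij)); have [f' fK f'K] := f_bij.
congr add_index; apply/seteqP; split.
- by move=> y yint; exists (f' y); [apply: (rmorph_ring_of_integers _).1; rewrite f'K | exact: f'K].
- by move=> _ [y yint <-]; apply/rmorph_ring_of_integers.
- move=> _ [P _ <-]; exists (map_poly intr P).[x]; first by exists P.
  exact: rmorph_horner_int.
- by move=> _ [_ [P _ <-] <-]; exists P => //; apply/esym/rmorph_horner_int.
Qed.

Lemma monogenic_indices_iso : monogenic_indices K = monogenic_indices L.
Proof.
have [f' fK f'K] := f_bij; apply/seteqP; split=> _ [x [xint genx] <-].
  exists (f x); last exact: add_index_int_adjoin_rmorph.
  by split; [apply/rmorph_ring_of_integers | apply/rmorph_primitive].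
exists (f' x); last by rewrite -add_index_int_adjoin_rmorph f'K.
by split; [apply: (rmorph_ring_of_integers _).1 | apply: (rmorph_primitive _).1]; rewrite f'K.
Qed.

End FieldMorphism.

Lemma min_index_mem (K : fieldExtType rat) :
  monogenic_indices K !=set0 -> monogenic_indices K (min_index K).
Proof.
move=> [k Sk]; pose S := monogenic_indices K.
have exS : exists k, `[< S k >] by exists k; apply/asboolP.
have exm : exists m, [set m | S m /\ forall k, S k -> (m <= k)%N] m.
  case: (ex_minnP exS) => m /asboolP Sm m_min; exists m; split=> // j Sj.
  by apply: m_min; apply/asboolP.
by have [] := xgetPex 0%N exm.
Qed.

Lemma exists_field_large_min_index (n N : nat) : (2 < n)%N ->
  exists K : fieldExtType rat, \dim {:K} = n /\ (N < min_index K)%N.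
Proof.
move=> n_gt2; have [K [dimK [a aint gena] idx]] := exists_field_large_indices N n_gt2.
exists K; split=> //.
have [|b [bint genb] <-] := @min_index_mem K; last exact: idx.
by eexists; exists a; first split.
Qed.

Theorem theorem1p1 (n N : nat) (hn : (2 < n)%N) (hN : (1 < N)%N) :
  exists K : nat -> fieldExtType rat,
    (forall i j : nat, i <> j -> ~ field_iso (K i) (K j)) /\
    (forall i : nat, \dim (fullv : {vspace K i}) = n /\ (N < min_index (K i))%N).
Proof.
have [F FP] := choice (fun B => exists_field_large_min_index B hn).
(* each minimal index becomes the lower bound imposed on the next field *)
pose B i := iter i (fun b => min_index (F b)) N.
have B_incr i : (B i < B i.+1)%N by case: (FP (B i)).
have B_mono i j : (i < j)%N -> (B i < B j)%N.
  by apply: (homo_ltn (r := fun x y => (x < y)%N)) => //; apply: ltn_trans.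
have B_inj i j : B i = B j -> i = j.
  by move=> eqB; case: (ltngtP i j) => // /B_mono; rewrite eqB ltnn.
exists (fun i => F (B i)); split=> [i j ij [f f_bij]|i].
  apply: ij; apply/succn_inj/B_inj.
  by rewrite /B !iterS /min_index (monogenic_indices_iso f_bij).
have [dimF ltB] := FP (B i); split=> //; apply: leq_ltn_trans ltB.
by elim: i {dimF} => // i IH; apply: leq_trans IH (ltnW (B_incr i)).
Qed.
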